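(* There is an integer $k_0$ such that the following holds for every integer $k \geq k_0$ that is a power of an odd prime. Let $n$ be the smallest integer such that $n > \frac{7}{4}k+\frac{1}{2}\sqrt{6k+6}+\frac{5}{4}$ and $\sqrt{2n-2k}$ is an integer. Let $m = \sqrt{2n-2k}$ and $r = 2k-n+m$, and let $L$ be a graph of order $n$ that is a vertex disjoint union of $m-1$ copies of $K_m$ and a copy of $K_r$. Then a partial $k$-star decomposition of $K_n$ whose leave is $L$ exists, and furthermore it has no embedding in a $k$-star decomposition of $K_{n+s}$ for any nonnegative integer $s < 4k-n$.
   Context: All graphs are finite and simple. A $k$-star is a complete bipartite graph $K_{1,k}$. A $k$-star decomposition of a graph $G$ is a set of $k$-stars that are subgraphs of $G$ such that each edge of $G$ is in exactly one of the $k$-stars. A partial $k$-star decomposition of $G$ is a set of $k$-stars that are subgraphs of $G$ such that each edge of $G$ is in at most one of the $k$-stars; its leave is the graph with vertex set $V(G)$ whose edges are exactly the edges of $G$ that are in none of its $k$-stars. An embedding of a partial $k$-star decomposition $\mathcal{A}$ of a graph $G$ is a partial $k$-star decomposition $\mathcal{B}$ of a graph $H$ such that $\mathcal{A} \subseteq \mathcal{B}$ and $G$ is a subgraph of $H$; we then say $\mathcal{A}$ is embedded in $\mathcal{B}$. $K_m$ denotes the complete graph on $m$ vertices. *)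

(* Defs.v *)
From HB Require Import structures.
From mathcomp Require Import all_boot all_order all_algebra.
From mathcomp Require Import reals.

Set Implicit Arguments.
Unset Strict Implicit.
Unset Printing Implicit Defensive.

Import Order.TTheory GRing.Theory Num.Theory.

(* A finite simple graph with vertex set T is given by its edge set, a set of
   2-element subsets of T; equality of graphs is equality of edge sets. *)
Record sgraph (T : finType) := SGraph {
  edges : {set {set T}};
  edges_card2 : [forall e in edges, #|e| == 2]
}.
HB.instance Definition _ (T : finType) := [isSub for @edges T].

Definition pairs (T : finType) (X : {set T}) : {set {set T}} :=
  [set e : {set T} | (e \subset X) && (#|e| == 2)].

Lemma pairs_card2 (T : finType) (X : {set T}) :
  [forall e in pairs X, #|e| == 2].
Proof. by apply/forall_inP => e; rewrite inE => /andP[]. Qed.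

Definition complete (n : nat) : sgraph 'I_n := SGraph (pairs_card2 [set: 'I_n]).

(* For k > 0 a star K_{1,k} has no isolated vertex, so it is determined by its
   edge set; stars are represented by their edge sets. For k = 1 this makes the
   choice of the centre immaterial, as it should be. *)
Definition is_star (T : finType) (k : nat) (S : {set {set T}}) : Prop :=
  exists (c : T) (X : {set T}),
    [/\ c \notin X, #|X| = k & S = [set [set c; x] | x in X]].

Section Decompositions.
Variables (T : finType) (k : nat) (G : sgraph T).
Implicit Type A : {set {set {set T}}}.

Definition stars_of A : Prop :=
  forall S, S \in A -> is_star k S /\ S \subset edges G.

Definition star_decomposition A : Prop :=
  stars_of A /\
  (forall e, e \in edges G -> #|[set S in A | e \in S]| = 1).

Definition partial_star_decomposition A : Prop :=
  stars_of A /\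
  (forall e, e \in edges G -> #|[set S in A | e \in S]| <= 1).

Lemma leave_card2 A : [forall e in edges G :\: cover A, #|e| == 2].
Proof.
apply/forall_inP => e; rewrite inE => /andP[_ eG].
exact: (forall_inP (edges_card2 G)).
Qed.

Definition leave A : sgraph T := SGraph (leave_card2 A).

End Decompositions.

(* B, on H, is an embedding of A, on G, where V(G) is identified with a subset
   of V(H) by the injection f. *)
Definition embedding (T U : finType) (k : nat) (f : T -> U)
    (G : sgraph T) (A : {set {set {set T}}})
    (H : sgraph U) (B : {set {set {set U}}}) : Prop :=
  [/\ injective f,
      [set f @: (e : {set T}) | e in edges G] \subset edges H,
      partial_star_decomposition k H B &
      [set [set f @: (e : {set T}) | e in (S : {set {set T}})] | S in A]
        \subset B].

(* L is the vertex disjoint union of a copies of K_m and one copy of K_r. *)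
Definition clique_union (T : finType) (a m r : nat) (L : sgraph T) : Prop :=
  exists (P : 'I_a -> {set T}) (Q : {set T}),
    [/\ (forall i, #|P i| = m) /\ #|Q| = r,
        (forall i j, i != j -> [disjoint P i & P j]) /\
        (forall i, [disjoint P i & Q]),
        (\bigcup_i P i) :|: Q = [set: T] &
        edges L = (\bigcup_i pairs (P i)) :|: pairs Q].

Local Open Scope ring_scope.

(* Num.sqrt is 0 on negative numbers, but the first condition forces x > k. *)
Definition admissible_order (R : realType) (k : nat) (x : int) : Prop :=
  7%:R / 4%:R * k%:R + 1 / 2%:R * Num.sqrt (6%:R * k%:R + 6%:R) + 5%:R / 4%:R
    < x%:~R :> R
  /\ Num.sqrt (2%:R * x%:~R - 2%:R * k%:R : R) \is a Num.int.

(* Main.v *)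
Require Import Defs.
From mathcomp Require Import all_boot all_order all_algebra.
From mathcomp Require Import reals.
From mathcomp Require Import zify ring lra.

(** Write [m = 2t+2]; the definitions of [m] and [r] give [k = r + t(2t+2)] and
    [n = r + (2t+1)(2t+2)], while the lower bound on [n] says exactly that
    [3k+3 < 2(m-1)^2].

    Existence.  The complement of [L] is complete multipartite with parts the
    [2t+1] cliques of order [m] and the clique of order [r].  A regular
    tournament on the [2t+1] blocks exists because their number is odd.  Each
    vertex of a block is the centre of one star, whose leaves are the [r]
    vertices of the clique of order [r] together with the [t] blocks that its own
    block beats: this makes [r + tm = k] leaves, and every edge between
    different parts is used once ([clique_union_is_leave]).

    Non-embeddability.  Let [N = n + s < 4k] and let [B] be a decomposition of
    the complete graph of order [N] that contains the stars of [A].  As [k] is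
    a prime power dividing [N(N-1)/2], it divides [N] or [N-1]
    ([prime_power_dvd_bin2]), so [N <= 2k+1] or [N] is [3k] or [3k+1].
    - An edge of a clique of order [m] lies in a new star, whose centre is a
      vertex of that clique and whose leaves are in that clique or outside
      [K_n].  This needs [k <= m-1+s] ([leave_degree_bound]), which fails when
      [N <= 2k+1].
    - The vertices that are centres of no new star are pairwise non-adjacent in
      the graph formed by the edges of the new stars, namely the join of [L]
      with the complete graph on the [s] added vertices.  An independent set of
      that join has at most [m] vertices, so there are at least [N - m] new
      stars ([card_new_stars]).  But edge counts give [|A| = m(m-1)]
      ([card_clique_union_stars]) and [|B| = N(N-1)/(2k)], and for [N = 3k] or
      [N = 3k+1] this leaves too few new stars because [3k+3 < 2(m-1)^2]. *)

Set Implicit Arguments.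
Unset Strict Implicit.
Unset Printing Implicit Defensive.

Import Order.TTheory GRing.Theory Num.Theory.

(** * Pairs, stars and leaves *)

Lemma mem_pairs2 (T : finType) (X : {set T}) (x y : T) :
  ([set x; y] \in pairs X) = [&& x \in X, y \in X & x != y].
Proof. by rewrite inE subUset !sub1set cards2 -andbA; case: (x != y). Qed.

Lemma pairsP (T : finType) (X e : {set T}) :
  reflect (exists x y, [/\ x \in X, y \in X, x != y & e = [set x; y]])
          (e \in pairs X).
Proof.
apply: (iffP idP) => [|[x [y [xX yX xy ->]]]]; last by rewrite mem_pairs2 xX yX.
move=> eX; have /cards2P[x [y [xy exy]]] : #|e| == 2.
  by move: eX; rewrite inE => /andP[].
by move: eX; rewrite exy mem_pairs2 => /and3P[xX yX _]; exists x, y.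
Qed.

Lemma card_pairs (T : finType) (X : {set T}) : #|pairs X| = 'C(#|X|, 2).
Proof. exact: cards_draws. Qed.

Lemma set2_inj_r (T : finType) (c x y : T) :
  x != c -> [set c; x] = [set c; y] -> x = y.
Proof.
move=> xc /setP/(_ x); rewrite !inE eqxx orbT (negbTE xc) /=.
by move/esym/eqP.
Qed.

Lemma card_star_at (T : finType) (c : T) (X : {set T}) :
  c \notin X -> #|[set [set c; x] | x in X]| = #|X|.
Proof.
move=> cX; apply: card_in_imset => x y xX _; apply: set2_inj_r.
by apply: contraNneq cX => <-.
Qed.

Lemma card_star (T : finType) k (S : {set {set T}}) : is_star k S -> #|S| = k.
Proof. by move=> [c [X [cX <- ->]]]; rewrite card_star_at. Qed.

Lemma edges_complete n : edges (complete n) = pairs [set: 'I_n].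
Proof. by []. Qed.

Lemma partial_uniq (T : finType) k (G : sgraph T) A e S S' :
  partial_star_decomposition k G A ->
  S \in A -> S' \in A -> e \in S -> e \in S' -> S = S'.
Proof.
move=> [starsA A1] SA S'A eS eS'.
have eG : e \in edges G by have [_ /subsetP] := starsA _ SA; apply.
have /card_le1_eqP := A1 e eG.
by apply; rewrite inE ?SA ?S'A ?eS ?eS'.
Qed.

Lemma decomposition_partial (T : finType) k (G : sgraph T) A :
  star_decomposition k G A -> partial_star_decomposition k G A.
Proof. by move=> [stA A1]; split=> // e /A1 ->. Qed.

Lemma decomposition_cover (T : finType) k (G : sgraph T) A e :
  star_decomposition k G A -> e \in edges G -> exists2 S, S \in A & e \in S.
Proof.
move=> [_ A1] /A1 /eqP /cards1P[S] /setP/(_ S); rewrite !inE eqxx.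
by case/andP => SA eS; exists S.
Qed.

(** The stars of a partial decomposition are disjoint sets of [k] edges. *)
Lemma card_edges_partial (T : finType) k (G : sgraph T) A :
  partial_star_decomposition k G A ->
  #|edges G| = k * #|A| + #|edges (leave G A)|.
Proof.
move=> pA; have [starsA _] := pA.
have covG : cover A \subset edges G.
  by apply/bigcupsP => S /starsA[].
have /eqP cardcov : trivIset A.
  apply/trivIsetP => S S' SA S'A; apply: contraR => /pred0Pn[e /andP[eS eS']].
  exact/eqP/(partial_uniq pA SA S'A eS eS').
rewrite -(cardsID (cover A) (edges G)) (setIidPr covG) -cardcov.
rewrite (eq_bigr (fun=> k)) => [|S /starsA[/card_star //]].
by rewrite sum_nat_const mulnC.
Qed.

Lemma card_edges_decomposition (T : finType) k (G : sgraph T) A :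
  star_decomposition k G A -> #|edges G| = k * #|A|.
Proof.
move=> dA; rewrite (card_edges_partial (decomposition_partial dA)).
suff -> : edges (leave G A) = set0 by rewrite cards0 addn0.
apply/eqP; rewrite setD_eq0; apply/subsetP => e /(decomposition_cover dA)[S SA eS].
by apply/bigcupP; exists S.
Qed.

Lemma card_bigcup_disjoint (T I : finType) (C : pred I) (F : I -> {set T}) d :
  (forall i j, i != j -> [disjoint F i & F j]) -> (forall i, #|F i| = d) ->
  #|\bigcup_(i | C i) F i| = #|C| * d.
Proof.
move=> disjF cardF; rewrite big_mkcond -sum1_card partition_disjoint_bigcup.
  rewrite -sum_nat_const [RHS]big_mkcond; apply: eq_bigr => i _.
  by rewrite sum1_card unfold_in; case: ifP => _; rewrite ?cards0.
move=> i j /disjF ij; case: ifP => _; last by rewrite disjoints_subset sub0set.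
by case: ifP => _ //; rewrite disjoint_sym disjoints_subset sub0set.
Qed.

(** * Disjoint unions of cliques *)

Section CliqueUnion.
Variables (T : finType) (a m r : nat) (L : sgraph T).
Variables (P : 'I_a -> {set T}) (Q : {set T}).
Hypothesis cardP : forall i, #|P i| = m.
Hypothesis cardQ : #|Q| = r.
Hypothesis disjP : forall i j, i != j -> [disjoint P i & P j].
Hypothesis disjQ : forall i, [disjoint P i & Q].
Hypothesis coverT : (\bigcup_i P i) :|: Q = [set: T].
Hypothesis edgesL : edges L = (\bigcup_i pairs (P i)) :|: pairs Q.

Lemma block_uniq i j x : x \in P i -> x \in P j -> i = j.
Proof.
move=> xi xj; apply/eqP; apply: contraTT xj => /disjP/disjointFr.
by move=> /(_ x xi) ->.
Qed.

Lemma block_notQ i x : x \in P i -> x \notin Q.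
Proof. by move=> xi; rewrite (disjointFr (disjQ i) xi). Qed.

Lemma block_or_rest x : (exists i, x \in P i) \/ x \in Q.
Proof.
have := in_setT x; rewrite -coverT inE => /orP[/bigcupP[i _ xi]|]; last by right.
by left; exists i.
Qed.

Lemma not_edge_out_block i x y :
  x \in P i -> y \notin P i -> [set x; y] \notin edges L.
Proof.
move=> xi yi; apply/negP; rewrite edgesL inE => /orP[/bigcupP[j _]|].
  by rewrite mem_pairs2 => /and3P[/(block_uniq xi) <- /(negP yi)].
by rewrite mem_pairs2 => /and3P[/(negP (block_notQ xi))].
Qed.

Lemma card_clique_union : #|T| = a * m + r.
Proof.
rewrite -cardsT -coverT cardsU disjoint_setI0 ?cards0 ?subn0; last first.
  by rewrite disjoint_sym; apply: bigcup_disjoint => i _; rewrite disjoint_sym.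
by rewrite cardQ (card_bigcup_disjoint _ disjP cardP) card_ord.
Qed.

Lemma card_edges_clique_union : #|edges L| = a * 'C(m, 2) + 'C(r, 2).
Proof.
have disj2 (X Y : {set T}) : [disjoint X & Y] -> [disjoint pairs X & pairs Y].
  move=> XY; apply/pred0Pn => -[_ /andP[/pairsP[x [y [xX _ _ ->]]] /=]].
  by rewrite mem_pairs2 (disjointFr XY xX).
rewrite edgesL cardsU disjoint_setI0 ?cards0 ?subn0; last first.
  by rewrite disjoint_sym; apply: bigcup_disjoint => i _; rewrite disjoint_sym disj2.
rewrite card_pairs cardQ; congr (_ + _).
rewrite (card_bigcup_disjoint _ (d := 'C(m, 2))) ?card_ord //.
  by move=> i j /disjP/disj2.
move=> i.
by rewrite card_pairs cardP.
Qed.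


(** * A star decomposition of the complement of a union of cliques *)

Section Existence.
Variables (k : nat) (arc : rel 'I_a).
Hypothesis arcC : forall i j, i != j -> arc i j = ~~ arc j i.
Hypothesis arcI : forall i, ~~ arc i i.

(** The common leaf set of the stars centred in block [i]: the rest [Q] and the
    blocks that [i] beats in the tournament [arc]. *)
Definition out_set i := Q :|: \bigcup_(j | arc i j) P j.

Definition block_star u i : {set {set T}} := [set [set u; x] | x in out_set i].

Definition block_stars : {set {set {set T}}} :=
  \bigcup_i [set block_star u i | u in P i].

Hypothesis card_out : forall i, #|out_set i| = k.

Lemma block_starsP S :
  reflect (exists i u, u \in P i /\ S = block_star u i) (S \in block_stars).
Proof.
apply: (iffP bigcupP) => [[i _ /imsetP[u ui ->]]|[i [u [ui ->]]]].
  by exists i, u.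
by exists i => //; apply: imset_f.
Qed.

Lemma out_setP i x :
  reflect (x \in Q \/ exists2 j, arc i j & x \in P j) (x \in out_set i).
Proof.
rewrite inE; apply: (iffP orP) => -[xQ|]; try by left.
  by move=> /bigcupP; right.
by move=> xj; right; apply/bigcupP.
Qed.

Lemma out_not_block i x : x \in out_set i -> x \notin P i.
Proof.
case/out_setP => [|[j ij xj]]; first exact/contraL/block_notQ.
by apply: contraL ij => xi; rewrite (block_uniq xj xi) arcI.
Qed.

(** Antisymmetry of the tournament, lifted to vertices: an edge is never used in
    both directions. *)
Lemma out_asym i j x y :
  x \in P i -> y \in P j -> y \in out_set i -> x \notin out_set j.
Proof.
move=> xi yj yout; have := out_not_block yout.
case/out_setP: yout => [/(negP (block_notQ yj)) //|[j' ij' yj']] yi.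
move: ij' yj'; case: (eqVneq j' j) => [-> ij _ | /eqP ne]; last first.
  by move=> _ /block_uniq/(_ yj)/ne.
apply/negP => /out_setP[/(negP (block_notQ xi)) //|[i' ji' xi']].
have ne : i != j by apply: contraNneq yi => ->.
by move: ji'; rewrite (block_uniq xi' xi); apply/negP; rewrite -arcC.
Qed.

Lemma is_star_block_star u i : u \in P i -> is_star k (block_star u i).
Proof.
move=> ui; exists u, (out_set i); split=> //.
by apply: contraL ui; exact: out_not_block.
Qed.

Lemma block_star_uniq e u i v j :
  u \in P i -> v \in P j -> e \in block_star u i -> e \in block_star v j ->
  block_star u i = block_star v j.
Proof.
move=> ui vj /imsetP[x xi ->] /imsetP[y yj E].
(* Two stars through a common edge have the same centre, or each centre is a
   leaf of the other star. *)
case: (eqVneq v u) => [vu|vu].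
  by move: vj; rewrite vu => /(block_uniq ui) ->.
have vx : v = x.
  have : v \in [set u; x] by rewrite E set21.
  by rewrite !inE (negbTE vu) => /eqP.
have uy : u = y.
  have : u \in [set v; y] by rewrite -E set21.
  by rewrite !inE eq_sym (negbTE vu) => /eqP.
by move: (out_asym ui vj); rewrite vx xi uy yj => /(_ isT).
Qed.

(** An edge outside [L] joins a block to [Q], or two blocks, one of which beats
    the other. *)
Lemma mem_cover_block_stars e : e \in pairs [set: T] ->
  (e \in cover block_stars) = (e \notin edges L).
Proof.
move=> eT; apply/idP/idP.
  case/bigcupP => _ /block_starsP[i [u [ui ->]]] /imsetP[x /out_not_block xi ->].
  exact: not_edge_out_block ui xi.
case/pairsP: eT => x [y [_ _ xy ->]] eL.
have cov u v i : u \in P i -> v \in out_set i ->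
    [set u; v] \in cover block_stars.
  move=> ui vi; apply/bigcupP; exists (block_star u i); last exact: imset_f.
  by apply/block_starsP; exists i, u.
case: (block_or_rest x) (block_or_rest y) => [[i xi]|xQ] [[j yj]|yQ].
- have ij : i != j.
    apply: contraNneq eL => ij; rewrite edgesL inE; apply/orP; left.
    by apply/bigcupP; exists j => //; rewrite mem_pairs2 -{1}ij xi yj.
  have [ar|] := boolP (arc i j).
    by apply: (cov _ _ i) => //; apply/out_setP; right; exists j.
  rewrite arcC // negbK => ar; rewrite setUC.
  by apply: (cov _ _ j) => //; apply/out_setP; right; exists i.
- by apply: (cov _ _ i) => //; apply/out_setP; left.
- by rewrite setUC; apply: (cov _ _ j) => //; apply/out_setP; left.
by case/negP: eL; rewrite edgesL inE mem_pairs2 xQ yQ xy orbT.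
Qed.

Lemma block_stars_decomposition (G : sgraph T) :
  edges G = pairs [set: T] ->
  partial_star_decomposition k G block_stars /\ leave G block_stars = L.
Proof.
move=> GT; split; last first.
  apply/val_inj/setP => e; rewrite /= GT inE andbC.
  case: (boolP (e \in pairs _)) => [eT|].
    by rewrite mem_cover_block_stars // negbK.
  move=> eT; apply/esym; apply: contraNF eT => eL; rewrite inE subsetT.
  exact: (forall_inP (edges_card2 L)).
split=> [S /block_starsP[i [u [ui ->]]]|e _].
  split; first exact: is_star_block_star.
  apply/subsetP => e /imsetP[x xi ->]; rewrite GT mem_pairs2 !inE /=.
  by apply: contraTneq ui => ->; exact: out_not_block.
apply/card_le1_eqP => S S'; rewrite !inE.
move=> /andP[/block_starsP[i [u [ui ->]]] eS] /andP[/block_starsP[j [v [vj ->]]] eS'].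
exact: block_star_uniq vj ui eS' eS.
Qed.

End Existence.

Lemma card_out_set (arc : rel 'I_a) d i :
  #|[pred j | arc i j]| = d -> #|out_set arc i| = r + d * m.
Proof.
move=> cardd; rewrite cardsU cardQ disjoint_setI0 ?cards0 ?subn0; last first.
  by apply: bigcup_disjoint => j _; rewrite disjoint_sym.
by congr (_ + _); rewrite (card_bigcup_disjoint _ disjP cardP) cardd.
Qed.

End CliqueUnion.

(** * Regular tournaments *)

(** Place the points on a circle of odd length [2t+1] and let each point beat the
    [t] points that follow it: exactly one of [x] and [-x] lies in [1..t]. *)
Lemma rotational_tournament t : exists arc : rel 'I_(t.*2.+1),
  [/\ forall i j, i != j -> arc i j = ~~ arc j i,
      forall i, ~~ arc i i &
      forall i, #|[pred j | arc i j]| = t].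
Proof.
pose near (x : 'I_(t.*2.+1)) := 0 < x <= t.
exists (fun i j => near (j - i)%R); split=> [i j ij|i|i].
- rewrite -[(i - j)%R]opprB; have : (j - i)%R != 0%R by rewrite subr_eq0 eq_sym.
  move: (j - i)%R => x; rewrite -val_eqE /= /near /= => x0.
  have xlt := ltn_ord x.
  rewrite modn_small; lia.
- by rewrite subrr.
rewrite -sum1_card (reindex (fun x => x + i)%R); last first.
  by exists (fun x => x - i)%R => x _; rewrite ?addrK ?subrK.
rewrite (eq_bigl near) => [|x]; last by rewrite inE addrK.
rewrite big_mkcond -(big_mkord predT (fun x => if 0 < x <= t then 1 else 0)) /=.
(* Stated for every upper bound [N] so that it can be proved by induction. *)
suff count N : \sum_(0 <= x < N) (if 0 < x <= t then 1 else 0) = minn N.-1 t.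
  by rewrite count; lia.
elim: N => [|N IH]; first by rewrite big_geq ?min0n.
by rewrite big_nat_recr //= IH; case: ifP; lia.
Qed.

Lemma clique_union_is_leave (T : finType) t r (G L : sgraph T) :
  edges G = pairs [set: T] ->
  clique_union (t.*2.+1) (t.*2.+2) r L ->
  exists A, partial_star_decomposition (r + t * t.*2.+2) G A /\ leave G A = L.
Proof.
move=> GT [P [Q [[cardP cardQ] [disjP disjQ] covT edgesL]]].
have [arc [arcC arcI arct]] := rotational_tournament t.
exists (block_stars P Q arc).
apply: (block_stars_decomposition disjP disjQ covT edgesL arcC arcI _ GT) => i.
exact: (card_out_set cardP cardQ disjP disjQ).
Qed.

(** * Stars of a decomposition of the larger complete graph *)

Definition image_graph (T U : finType) (f : T -> U) (S : {set {set T}}) :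
  {set {set U}} := [set f @: (e : {set T}) | e in S].

(** [A] decomposes the complete graph on [T] up to the leave [L], and the larger
    decomposition [B] on [U] contains its image [old] under [f]; the stars of
    [B] outside [old] are the new ones. *)
Section Embedding.
Variables (T U : finType) (k : nat) (G : sgraph T) (H : sgraph U) (f : T -> U).
Variables (A : {set {set {set T}}}) (B : {set {set {set U}}}).
Variables (a m r : nat) (L : sgraph T).
Hypothesis GT : edges G = pairs [set: T].
Hypothesis HU : edges H = pairs [set: U].
Hypothesis f_inj : injective f.
Hypothesis dB : star_decomposition k H B.
Hypothesis AB : [set image_graph f S | S in A] \subset B.
Hypothesis leaveA : leave G A = L.
Hypothesis cuL : clique_union a m r L.

Let old := [set image_graph f S | S in A].

Lemma mem_leave e : e \in pairs [set: T] -> (e \in edges L) = (e \notin cover A).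
Proof. by move=> eT; rewrite -leaveA inE GT eT andbT. Qed.

Lemma imset_pair x y : f @: [set x; y] = [set f x; f y].
Proof. by rewrite imsetU !imset_set1. Qed.

Lemma covered_in_old x y : x != y -> [set x; y] \notin edges L ->
  exists2 S, S \in old & [set f x; f y] \in S.
Proof.
move=> xy; rewrite mem_leave ?mem_pairs2 ?inE // negbK => /bigcupP[S SA eS].
by exists (image_graph f S); [exact: imset_f | rewrite -imset_pair; exact: imset_f].
Qed.

Lemma old_not_leave S e : S \in old -> e \in S ->
  exists2 e0 : {set T}, e = f @: e0 & e0 \notin edges L.
Proof.
case/imsetP => S0 S0A -> /imsetP[e0 e0S ->]; exists e0 => //.
apply/negP; rewrite -leaveA inE => /andP[/bigcupP[]].
by exists S0.
Qed.

Lemma leave_edge_new S x y : S \in old -> [set x; y] \in edges L ->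
  [set f x; f y] \notin S.
Proof.
move=> So xyL; apply/negP => /(old_not_leave So)[e0].
by rewrite -imset_pair => /(imset_inj f_inj) <-; rewrite xyL.
Qed.

Lemma card_old : #|old| = #|A|.
Proof. by apply: card_imset; apply: imset_inj; exact: imset_inj. Qed.

Lemma star_center S : is_star k S -> exists c, [forall e in S, c \in (e : {set U})].
Proof.
case=> c [X [_ _ ->]]; exists c.
by apply/forall_inP => _ /imsetP[x _ ->]; rewrite set21.
Qed.

(** Every edge between two vertices that are centres of no new star is in an old
    star, so such vertices come from distinct cliques of [L], unless there is
    just one of them.  With [a] cliques [P i] and the clique [Q], there are at
    most [a.+1] of them, and the other vertices are centres of distinct new
    stars. *)
Lemma card_new_stars : #|U| <= #|B :\: old| + a.+1.
Proof.
have [P [Q [[cardP cardQ] [disjP disjQ] covT edgesL]]] := cuL.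
(* Some vertex common to all the edges of [S]; for stars with a single edge this
   picks one of its two possible centres, which is enough. *)
pose ctr (S : {set {set U}}) := [pick c | [forall e in S, c \in (e : {set U})]].
pose ctrs := ctr @: (B :\: old).
pose Z := [set x | Some x \notin ctrs].
have oldZ x y : x \in Z -> y \in Z -> x != y ->
    exists x0 y0, [/\ x = f x0, y = f y0, x0 != y0 & [set x0; y0] \notin edges L].
  move=> xZ yZ xy.
  have [|S SB eS] := decomposition_cover dB (e := [set x; y]).
    by rewrite HU mem_pairs2 !inE.
  have [So|So] := boolP (S \in old).
    have [e0 exy e0L] := old_not_leave So eS.
    have /imsetP[x0 x0e xf] : x \in f @: e0 by rewrite -exy set21.
    have /imsetP[y0 y0e yf] : y \in f @: e0 by rewrite -exy set22.
    exists x0, y0; split=> //; first by apply: contraNneq xy => E; rewrite xf yf E.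
    by move: exy; rewrite xf yf -imset_pair => /(imset_inj f_inj) ->.
  have cS : ctr S \in ctrs by apply: imset_f; rewrite inE So.
  have [c cc] : exists c, [forall e in S, c \in (e : {set U})].
    by apply: star_center; case: dB => stB _; have [] := stB S SB.
  move: cS; rewrite /ctr; case: pickP => [c'|/(_ c)]; last by rewrite cc.
  move=> /forall_inP/(_ _ eS).
  move: xZ yZ; rewrite !inE => xZ yZ /orP[]/eqP -> ctrS.
    by case/negP: xZ.
  by case/negP: yZ.
(* The clique that a vertex comes from; [None] stands for [Q] and, harmlessly,
   for the vertices outside the image of [f]. *)
pose cls (u : U) : option 'I_a := [pick i | u \in f @: P i].
have cls_inj : {in Z &, injective cls}.
  move=> x y xZ yZ; apply: contra_eq => xy.
  have [x0 [y0 [-> -> xy0 xyL]]] := oldZ x y xZ yZ xy.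
  apply: contraNneq xyL; rewrite edgesL inE /cls.
  case: pickP => [i|xN]; case: pickP => [j|yN] //.
    rewrite !(mem_imset _ _ f_inj) => y0j x0i [ij]; apply/orP; left.
    by apply/bigcupP; exists j => //; rewrite mem_pairs2 -{1}ij x0i y0j.
  move=> _; rewrite mem_pairs2 xy0 andbT; apply/orP; right; apply/andP; split.
    case: (block_or_rest covT x0) => // -[i xi].
    by have := xN i; rewrite (mem_imset _ _ f_inj) xi.
  case: (block_or_rest covT y0) => // -[i yi].
  by have := yN i; rewrite (mem_imset _ _ f_inj) yi.
have cardZ : #|Z| <= a.+1.
  rewrite -(card_in_imset cls_inj) (leq_trans (max_card _)) //.
  by rewrite card_option card_ord.
have cardZC : #|~: Z| <= #|B :\: old|.
  rewrite (leq_trans _ (leq_imset_card ctr _)) //.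
  rewrite -(card_imset _ (pcan_inj (g := id) (f := Some) _)) //; apply: subset_leq_card.
  by apply/subsetP => _ /imsetP[x xZ ->]; move: xZ; rewrite !inE negbK.
by rewrite -(cardsC Z) addnC leq_add.
Qed.

(** An edge inside a clique of order [m] is in a new star centred in that clique.
    Its [k] leaves avoid the centre and the image of every other clique, since
    the edges to the latter are in old stars. *)
Lemma leave_degree_bound : 0 < a -> 1 < m -> k + #|T| < #|U| + m.
Proof.
move=> a0 m1.
have [P [Q [[cardP cardQ] [disjP disjQ] covT edgesL]]] := cuL.
pose i := Ordinal a0.
have inL x y : x \in P i -> y \in P i -> x != y -> [set x; y] \in edges L.
  move=> xi yi xy; rewrite edgesL inE; apply/orP; left; apply/bigcupP; exists i => //.
  by rewrite mem_pairs2 xi yi.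
(* Such an edge has both ends in [P i], so whichever is the centre will do. *)
have [S [SB So [x xi [X [fxX cardX Sdef]]]]] : exists S : {set {set U}},
    [/\ S \in B, S \notin old &
    exists2 x, x \in P i &
      exists X : {set U},
        [/\ f x \notin X, #|X| = k & S = [set [set f x; y] | y in X]]].
  have /card_gt1P[x [y [xi yi xy]]] : 1 < #|P i| by rewrite cardP.
  have [|S SB eS] := decomposition_cover dB (e := [set f x; f y]).
    by rewrite HU mem_pairs2 !inE (inj_eq f_inj).
  exists S; split=> //.
    by apply: contraL eS => So; apply: leave_edge_new => //; exact: inL.
  case: dB => /(_ S SB)[[c [X [cX cardX Sdef]]] _] _.
  move: eS; rewrite Sdef => /imsetP[z _ E].
  have : c \in [set f x; f y] by rewrite E set21.
  rewrite !inE => /orP[]/eqP cE.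
    by exists x => //; exists X; rewrite -cE.
  by exists y => //; exists X; rewrite -cE.
have Xsub : X \subset ~: (f x |: f @: (~: P i)).
  apply/subsetP => z zX; rewrite !inE negb_or; apply/andP; split.
    by apply: contraNneq fxX => <-.
  apply/imsetP => -[y yi zy]; rewrite inE in yi.
  have xy : x != y by apply: contraNneq yi => <-.
  have eS : [set f x; f y] \in S by rewrite Sdef -zy; apply: imset_f.
  have [S' S'o eS'] :=
    covered_in_old xy (not_edge_out_block disjP disjQ edgesL xi yi).
  have SS' : S = S'.
    by apply: (partial_uniq (decomposition_partial dB) SB _ eS eS'); exact: (subsetP AB).
  by rewrite SS' S'o in So.
have := subset_leq_card Xsub; rewrite cardX.
have := cardsC (f x |: f @: (~: P i)); have := cardsC (P i).
rewrite cardsU1 (mem_imset _ _ f_inj) inE xi /= card_imset // cardP.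
by lia.
Qed.
End Embedding.

(** * Arithmetic *)

Lemma bin2_double N : 2 * 'C(N, 2) = N * N.-1.
Proof. by rewrite -mul_bin_diag bin1. Qed.

(** [N] and [N.-1] are coprime, so a prime power cannot be split between them. *)
Lemma prime_power_dvd_bin2 p b N :
  prime p -> p ^ b %| 'C(N, 2) -> (p ^ b %| N) || (p ^ b %| N.-1).
Proof.
move=> pp dvdC; case: N dvdC => [|N dvdC]; first by rewrite dvdn0.
have dvdN : p ^ b %| N.+1 * N by rewrite -(bin2_double N.+1) dvdn_mull.
have [pN|pN] := boolP (p %| N).
  have copS : coprime (p ^ b) N.+1.
    by apply: coprimeXl; apply: coprime_dvdl pN (coprimenS N).
  by move: dvdN; rewrite (Gauss_dvdr _ copS) /= => ->; rewrite orbT.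
have cop : coprime (p ^ b) N by apply: coprimeXl; rewrite prime_coprime.
by move: dvdN; rewrite (Gauss_dvdl _ cop) => ->.
Qed.

(** All decompositions with leave [L] have equally many stars, hence as many as
    the one above, which has one star at each vertex of the cliques of order
    [2t+2]. *)
Lemma card_clique_union_stars (T : finType) k t r (G L : sgraph T) A :
  0 < k -> k = r + t * t.*2.+2 -> edges G = pairs [set: T] ->
  partial_star_decomposition k G A -> leave G A = L ->
  clique_union t.*2.+1 t.*2.+2 r L -> #|A| = t.*2.+1 * t.*2.+2.
Proof.
move=> k0 kr GT pA leaveA [P [Q [[cardP cardQ] [disjP disjQ] covT edgesL]]].
have := card_edges_partial pA.
rewrite leaveA (card_edges_clique_union cardP cardQ disjP disjQ edgesL).
rewrite GT card_pairs cardsT (card_clique_union cardP cardQ disjP disjQ covT).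
set n := _ + r => E.
have sq x : x * x.-1 + x = x ^ 2 by case: x => [|x] //=; ring.
move: (sq n) (sq r) E; rewrite -!bin2_double => sqn sqr E.
have E2 := bin2_double t.*2.+2; rewrite /= -!mul2n in E2 E *.
apply/eqP; rewrite -(eqn_pmul2l k0) -(eqn_pmul2l (isT : 0 < 2)); apply/eqP.
have nE : n = r + 4 * t ^ 2 + 6 * t + 2 by rewrite /n -!mul2n; ring.
have sqnE : n ^ 2 = (r + 4 * t ^ 2 + 6 * t + 2) ^ 2 by rewrite nE.
have F : 2 * (k * ((2 * t).+1 * (2 * t).+2)) =
   2 * (r + 2 * t ^ 2 + 2 * t) * ((2 * t).+1 * (2 * t).+2).
  by rewrite kr -mul2n; ring.
clearbody n; rewrite F; move: (k * #|A|) E => X E; lia.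
Qed.

(** With [w = sqrt (6k+6)] the lower bound on [n] reads
    [m^2 = 2n - 2k > 3k/2 + w + 5/2 = (1 + w/2)^2]. *)
Lemma admissible_bounds (R : realType) k n m :
  admissible_order R k n%:Z ->
  (m%:R = Num.sqrt (2%:R * n%:R - 2%:R * k%:R) :> R)%R ->
  [/\ m ^ 2 + 2 * k = 2 * n, 3 * k + 3 < 2 * (m - 1) ^ 2 & 0 < m].
Proof.
move=> [n_gt _] mE; rewrite -pmulrn in n_gt.
set w := Num.sqrt _ in n_gt.
have w0 : (0 <= w)%R by exact: sqrtr_ge0.
have w2 : (w ^+ 2 = 6%:R * k%:R + 6%:R)%R.
  by rewrite sqr_sqrtr //; have := ler0n R k; lra.
have k0 := ler0n R k.
have m2 : (m%:R ^+ 2 = 2%:R * n%:R - 2%:R * k%:R :> R)%R.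
  by rewrite mE sqr_sqrtr //; lra.
have m0 := ler0n R m.
(* Otherwise [m^2 <= (w/2 + 1)^2], against the bound on [n]. *)
have mw : (w / 2%:R + 1 < m%:R)%R by nra.
have mpos : 0 < m by rewrite -(ltr0n R); lra.
split=> //.
  apply/eqP; rewrite -(eqr_nat R) natrD natrX m2 !natrM; apply/eqP; lra.
by rewrite -(ltr_nat R) natrD 2!natrM natrX natrB //; nra.
Qed.

Lemma small_multiple_cases k N : 0 < k -> k.+1 < N -> N < 4 * k ->
  (k %| N) || (k %| N.-1) ->
  N <= (2 * k).+1 \/ N = 3 * k \/ N = (3 * k).+1.
Proof.
move=> k0 kN N4 /orP[] /dvdnP[q]; [move=> E | move=> E];
 have : q < 4 by nia.
all: by case: q E => [|[|[|[|q]]]]; lia.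
Qed.

Theorem lemma21 (R : realType) :
  exists k0 : nat, forall k : nat, k0 <= k ->
  (exists p a : nat, [/\ prime p, odd p, 0 < a & k = p ^ a]) ->
  forall n m r : nat,
  admissible_order R k n%:Z ->
  (forall x : int, admissible_order R k x -> (n%:Z <= x)%R) ->
  (m%:R = Num.sqrt (2%:R * n%:R - 2%:R * k%:R) :> R)%R ->
  (r%:Z = 2%:Z * k%:Z - n%:Z + m%:Z)%R ->
  forall L : sgraph 'I_n,
  clique_union (m - 1) m r L ->
  (exists A : {set {set {set 'I_n}}},
     partial_star_decomposition k (complete n) A /\
     leave (complete n) A = L) /\
  (forall A : {set {set {set 'I_n}}},
     partial_star_decomposition k (complete n) A ->
     leave (complete n) A = L ->
     forall s : nat, (s%:Z < 4%:Z * k%:Z - n%:Z)%R ->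
     ~ exists (f : 'I_n -> 'I_(n + s)) (B : {set {set {set 'I_(n + s)}}}),
         star_decomposition k (complete (n + s)) B /\
         embedding k f (complete n) A (complete (n + s)) B).
Proof.
exists 0 => k _ [p [b [pp _ _ kE]]] n m r adm _ mE rE L cuL.
have [m2 mk m0] := admissible_bounds adm mE.
have k0 : 0 < k by rewrite kE expn_gt0 prime_gt0.
have [t [mt t0]] : exists t, m = t.*2.+2 /\ 0 < t.
  have : ~~ odd (m ^ 2) by rewrite (_ : m ^ 2 = 2 * (n - k)) ?oddM //; lia.
  rewrite oddX /= => m_even; exists (m./2.-1).
  have m3 : 2 < m by case: m mk {m2 mE rE cuL m0 m_even} => [|[|[|m]]]; lia.
  by split; lia.
subst m.
have m2E : (t.*2.+2) ^ 2 = 4 * t ^ 2 + 8 * t + 4 by rewrite -mul2n; ring.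
have kr : k = r + t * t.*2.+2 by rewrite -mul2n; lia.
have nr : n = k + 2 * t ^ 2 + 4 * t + 2 by lia.
rewrite subn1 /= in cuL mk; split.
  by have [A] := clique_union_is_leave (edges_complete n) cuL; rewrite -kr; exists A.
move=> A pA leaveA s sk [f [B [dB [f_inj _ _ AB]]]].
have AB' : [set image_graph f S | S in A] \subset B by exact: AB.
have cardA : #|A| = t.*2.+1 * t.*2.+2 :=
  card_clique_union_stars k0 kr (edges_complete n) pA leaveA cuL.
have cardB : 'C(n + s, 2) = k * #|B|.
  by rewrite -(card_edges_decomposition dB) edges_complete card_pairs cardsT card_ord.
have degN := leave_degree_bound (edges_complete n) (edges_complete _) f_inj dB AB'
               leaveA cuL isT isT.
have newN := card_new_stars (edges_complete _) f_inj dB leaveA cuL.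
rewrite cardsD (setIidPr AB') card_old // cardA !card_ord in newN.
rewrite !card_ord in degN.
have AleB : #|A| <= #|B| by rewrite -(card_old A f_inj) subset_leq_card.
have dvdN : k %| 'C(n + s, 2) by rewrite cardB dvdn_mulr.
rewrite kE in dvdN; have := prime_power_dvd_bin2 pp dvdN; rewrite -kE.
have N4 : n + s < 4 * k by lia.
have kN : k.+1 < n + s by lia.
move=> /(small_multiple_cases k0 kN N4).
have B2 := bin2_double (n + s); rewrite cardB in B2.
have mkE : 2 * t.*2.+1 ^ 2 = 8 * t ^ 2 + 8 * t + 2 by rewrite -mul2n; ring.
have cardAE : t.*2.+1 * t.*2.+2 = 4 * t ^ 2 + 6 * t + 2 by rewrite -mul2n; ring.
rewrite cardA in AleB.
(* [N <= 2k+1] contradicts [degN]; the two other orders contradict [newN] and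
   [mk]. *)
case=> [|[] NE]; first by lia.
  have : 2 * #|B| = 3 * (3 * k).-1.
    by apply/eqP; rewrite -(eqn_pmul2l k0) mulnCA B2 NE -mulnA mulnCA.
  by lia.
have : 2 * #|B| = 3 * (3 * k).+1.
  by apply/eqP; rewrite -(eqn_pmul2l k0) mulnCA B2 NE /= mulnC -mulnA mulnCA.
by lia.
Qed.
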